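(* Let $G=(V,E)$ be a directed graph with $V=\omega$ that is locally finite, i.e. $|N^+(v)|$ is finite for every $v\in V$. Then $G$ is dangerous if and only if $G$ contains a directed cycle.
   Context: A directed graph is a pair $G=(V,E)$ with $V$ a set and $E\subseteq V^2$. For $v\in V$, $N^+(v)=\{w\in V:(v,w)\in E\}$. A directed cycle is a sequence of distinct vertices $v_1,\dots,v_n$ ($n\ge 1$) with $(v_i,v_{i+1})\in E$ for $i<n$ and $(v_n,v_1)\in E$. For $\alpha\in 2^V$ and $I\subseteq V$, let $\alpha^I=\{\beta\in 2^V:\beta(x)=\alpha(x)\text{ for all }x\in V\setminus I\}$. A function $g:2^V\to 2$ is independent of $I\subseteq V$ if $g$ is constant on $\alpha^I$ for every $\alpha\in 2^V$. A function $f:2^V\to 2^V$ respects $G$ if for every $v\in V$ the function $f^v(x)=f(x)(v)$ is independent of $V\setminus N^+(v)$. $\mathfrak{R}(G)$ is the set of all $f:2^V\to 2^V$ respecting $G$. The graph $G$ is dangerous if $\mathfrak{R}(G)$ contains a function with no fixed point. *)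

(* Defs.v *)
From mathcomp Require Import all_boot.
From mathcomp Require Import boolp classical_sets cardinality.

Set Implicit Arguments.
Unset Strict Implicit.
Unset Printing Implicit Defensive.

Local Open Scope classical_set_scope.

Definition digraph (V : Type) := set (V * V).

(* The set 2^V. *)
Definition cantor (V : Type) := V -> bool.

Definition out_nbhd (V : Type) (G : digraph V) (v : V) : set V :=
  [set w | G (v, w)].

Definition locally_finite (V : Type) (G : digraph V) : Prop :=
  forall v : V, finite_set (out_nbhd G v).

(* [ucycle] requires the vertices to be distinct and the last one to have an
   edge to the first; a loop is a cycle of length 1. *)
Definition directed_cycle (V : eqType) (G : digraph V) (s : seq V) : Prop :=
  s <> [::] /\ ucycle [rel x y | (x, y) \in G] s.

(* The set alpha^I of points that agree with alpha outside I. *)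
Definition variants (V : Type) (I : set V) (alpha : cantor V) :
    set (cantor V) :=
  [set beta | forall x, (setT `\` I) x -> beta x = alpha x].

Definition independent (V : Type) (I : set V) (g : cantor V -> bool) : Prop :=
  forall alpha beta gamma : cantor V,
    variants I alpha beta -> variants I alpha gamma -> g beta = g gamma.

Definition respects (V : Type) (G : digraph V)
    (f : cantor V -> cantor V) : Prop :=
  forall v : V, independent (setT `\` out_nbhd G v) (fun x => f x v).

Definition respecting (V : Type) (G : digraph V) :
    set (cantor V -> cantor V) :=
  [set f | respects G f].

Definition dangerous (V : Type) (G : digraph V) : Prop :=
  exists2 f, respecting G f & forall x : cantor V, f x <> x.

(* Main.v *)
(** A cycle v_1 -> ... -> v_n -> v_1 carries a function copying the value at
    v_{i+1} to v_i, except for one negation, so that a fixed point would give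
    a bit equal to its negation.
    Conversely, let G have no cycle and let f respect G.  For every finite set A
    some x satisfies f(x) = x on A: A has a vertex v with no incoming edge from
    A, and changing at v a solution for A \ {v} does not disturb the other
    equations.  A limit of the solutions for {0, ..., n-1} along a nonprincipal
    ultrafilter is a fixed point, because f(x)(v) depends on the restriction of
    x to the finite set N^+(v) only. *)
Require Import Defs.
From mathcomp Require Import all_boot.
From mathcomp Require Import boolp classical_sets cardinality filter.

Set Implicit Arguments.
Unset Strict Implicit.
Unset Printing Implicit Defensive.

Local Open Scope classical_set_scope.

Lemma respectsP (V : Type) (G : digraph V) (f : cantor V -> cantor V) :
  respects G f <->
  forall v x y, (forall w, G (v, w) -> x w = y w) -> f x v = f y v.
Proof.
split=> [rf v x y xy | fP v a b c ba ca].
  apply: (rf v x x y) => // w [_ /= nnG]; symmetry; apply: xy.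
  by apply: contrapT => nG; apply: nnG.
apply: fP => w Gvw.
by rewrite (ba w) ?(ca w) //; split=> //; case.
Qed.

Lemma cycle_dangerous (V : eqType) (G : digraph V) (s : seq V) :
  directed_cycle G s -> dangerous G.
Proof.
case: s => [[]//|v p] [_ /andP[Gs Us]]; set s := v :: p in Gs Us.
(* The negation sits on the edge that closes the cycle, the one into [v]; off the cycle the value is
   constantly false. *)
exists (fun x u => (u \in s) && ((next s u == v) (+) x (next s u))).
  apply/respectsP => u x y xy; case us: (u \in s) => //=.
  by rewrite xy //; have := next_cycle Gs us; rewrite /= inE.
move=> x xfix.
have xE u : u \in s -> x u = (next s u == v) (+) x (next s u).
  by move=> us; rewrite -{1}xfix us.
have /= := cycle_next Us; rewrite rcons_path => /andP[ps /eqP lastv].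
(* A walk along the cycle from [v] that does not return to [v] meets no negation, so the bit at [v]
   is carried to its end. *)
have xv q : fpath (next s) v q -> v \notin q -> {subset v :: q <= s} ->
    x (last v q) = x v.
  elim/last_ind: q => [//|q w IH].
  rewrite rcons_path last_rcons mem_rcons inE negb_or.
  move=> /andP[pq /eqP wE] /andP[vw vq] qs.
  have qs' : {subset v :: q <= s}.
    by move=> u uq; apply: qs; rewrite -rcons_cons mem_rcons in_cons uq orbT.
  by rewrite -(IH pq vq qs') [RHS]xE ?qs' ?mem_last // wE eq_sym (negPf vw).
have /andP[vp _] := Us.
have := xE _ (mem_last v p); rewrite xv // lastv eqxx.
by case: (x v).
Qed.

(** Otherwise every vertex of [A] has a predecessor in [A], and walking backwards yields a path in
    [A] with more distinct vertices than [A] has entries. *)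
Lemma acyclic_source (T : eqType) (e : rel T) (A : seq T) :
  (forall s, s <> [::] -> ~ ucycle e s) -> A <> [::] ->
  exists2 v, v \in A & forall w, w \in A -> ~~ e w v.
Proof.
move=> acyc A0; apply: contrapT => noS.
have pred v : v \in A -> exists2 w, w \in A & e w v.
  move=> vA; apply: contrapT => noP; apply: noS; exists v => // w wA.
  by apply/negP => ewv; apply: noP; exists w.
have [x [p [sp Up pA _]]] : exists x p,
    [/\ size p = size A, uniq (x :: p), {subset x :: p <= A} & path e x p].
  elim: (size A) => [|n [x [p [<- Up pA ep]]]].
    case: A A0 {noS pred} => // x A _; exists x, [::]; split=> // y.
    by rewrite !inE => ->.
  have [y yA eyx] := pred x (pA x (mem_head _ _)).
  have yp : y \notin x :: p.
    (* If [y] were already on the path, the initial segment ending at [y] would close up through the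
       edge from [y] to [x]. *)
    apply/negP => /splitPl yp; case: yp Up ep => p1 p2 lastp.
    rewrite -cat_cons cat_uniq cat_path => /andP[Up1 _] /andP[ep1 _].
    by apply: (acyc (x :: p1)) => //; rewrite /ucycle /= rcons_path ep1 lastp eyx.
  exists y, (x :: p); split=> //=; last by rewrite eyx.
    by rewrite yp.
  by move=> z; rewrite inE => /predU1P[->//|]; apply: pA.
by have := uniq_leq_size Up pA; rewrite /= sp ltnn.
Qed.

Lemma acyclic_finite_fixed (V : eqType) (G : digraph V)
    (f : cantor V -> cantor V) (A : seq V) :
  (forall s, ~ directed_cycle G s) -> respects G f ->
  exists x : cantor V, forall v, v \in A -> f x v = x v.
Proof.
move=> acyc /respectsP rf.
have [n] := ubnP (size A); elim: n A => // n IH A.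
have [->|/eqP A0 sA] := eqVneq A [::]; first by exists (fun=> false).
have [|v vA src] := @acyclic_source V [rel x y | (x, y) \in G] A _ A0.
  by move=> s s0 cs; apply: (acyc s).
have [|x xP] := IH (rem v A).
  by rewrite size_rem //; case: (A) A0 sA.
pose x' : cantor V := fun w => if w == v then f x v else x w.
(* No vertex of [A], [v] included, has an edge to [v], the only place where [x'] may differ from
   [x]. *)
have fx' w : w \in A -> f x' w = f x w.
  move=> wA; apply: rf => u Gwu; rewrite /x'; case: eqP => // uv.
  by have := src w wA; rewrite /= -uv mem_set.
exists x' => w wA; rewrite fx' // /x'; case: (eqVneq w v) => [->//|wv].
by apply: xP; rewrite rem_mem.
Qed.

(** At each [v] the ultrafilter decides which bit is taken on a large set of indices; that bit is
    the value of the limit. *)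
Lemma ultra_limit (V T : Type) (U : set_system T) (x_ : T -> cantor V) :
  UltraFilter U -> exists x : cantor V, forall v, U [set t | x_ t v = x v].
Proof.
move=> UU; exists (fun v => `[< U [set t | x_ t v] >]) => v.
have [Uv|Uv] := in_ultra_setVsetC [set t | x_ t v] UU.
  by rewrite (asboolT Uv); exact: Uv.
have -> : `[< U [set t | x_ t v] >] = false.
  apply: asboolF => Uv'; apply: (@filter_not_empty _ U).
  by rewrite -(setICr [set t | x_ t v]); apply: filterI.
by apply: filterS Uv => t /= /negP/negPf.
Qed.

Lemma filter_all_seq (T : Type) (I : eqType) (F : set_system T)
    (P : I -> set T) (s : seq I) :
  Filter F -> (forall i, F (P i)) -> F [set t | forall i, i \in s -> P i t].
Proof.
move=> FF FP; elim: s => [|i s IH].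
  by apply: filterS filterT => t _ i.
apply: filterS (filterI (FP i) IH) => t [Pi Ps] j.
by rewrite inE => /predU1P[->//|]; apply: Ps.
Qed.

Lemma acyclic_fixed (G : digraph nat) (f : cantor nat -> cantor nat) :
  locally_finite G -> (forall s, ~ directed_cycle G s) -> respects G f ->
  exists x, f x = x.
Proof.
move=> Gfin acyc rf.
have [x_ x_P] := choice (fun n => acyclic_finite_fixed (iota 0 n) acyc rf).
have [U [UU evU]] := ultraFilterLemma eventually_filter.
have [x xP] := ultra_limit x_ UU.
exists x; apply/funext => v.
have /finite_seqP[s sE] := Gfin v.
(* Local finiteness enters here: a single index [n] can serve [v] and all its out-neighbours, listed
   by [s]. *)
have Us : U [set n | forall w, w \in v :: s -> x_ n w = x w].
  exact: filter_all_seq xP.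
have Uv : U [set n | v < n] by apply: evU; exists v.+1.
have [n [ns /= vn]] := filter_ex (filterI Us Uv).
rewrite -[RHS]ns ?mem_head // -x_P ?mem_iota //.
move/respectsP: rf; apply=> w Gvw; rewrite -ns // inE.
have : [set` s] w by rewrite -sE.
by move=> /= ->; rewrite orbT.
Qed.

Theorem theorem3p3 (G : digraph nat) (G_locfin : locally_finite G) :
  dangerous G <-> exists s : seq nat, directed_cycle G s.
Proof.
split=> [[f rf nofix]|[s /cycle_dangerous//]].
apply: contrapT => acyc.
have [|x] := acyclic_fixed G_locfin _ rf; last exact: nofix.
by move=> s cs; apply: acyc; exists s.
Qed.
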